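(* Let $0<\alpha<1$, let $T=T_\alpha:[0,1)\to[0,1)$ be the intermittent map and let $\mu$ be its absolutely continuous invariant probability measure. Let $(k(n))_{n}$ be any sequence of positive integers satisfying $\limsup_{n\to\infty}\frac{k(n)}{\log_2 n}\le 1$. Then for $\mu$-almost every $x\in[0,1)$, $$\lim_{n\to\infty}\frac{\max\{S_{k(n)}(\chi_{I_1})(T^i(x)):\ 0\le i\le n-k(n)\}}{k(n)}=1,$$ where $i$ ranges over integers.
   Context: For $0<\alpha<1$ the intermittent map $T=T_\alpha:[0,1)\to[0,1)$ is defined by $T_\alpha(x)=x(1+2^\alpha x^\alpha)$ if $0\le x<1/2$, and $T_\alpha(x)=2x-1$ if $1/2\le x<1$. It is known that $T_\alpha$ has a unique invariant probability measure absolutely continuous with respect to Lebesgue measure; this measure is denoted $\mu$. Let $I_1=[1/2,1)$, let $\chi_{I_1}$ be its indicator function, and for integers $n\ge1$ let $S_n(\chi_{I_1})(x)=\sum_{i=1}^{n}\chi_{I_1}(T^i(x))$. The condition on $k(n)$ guarantees $k(n)\le n$ for all large $n$, so the maximum is over a nonempty set for all large $n$. *)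

(* Defs.v *)
From HB Require Import structures.
From mathcomp Require Import all_boot all_order all_algebra.
From mathcomp Require Import all_classical all_reals all_analysis.

Set Implicit Arguments.
Unset Strict Implicit.
Unset Printing Implicit Defensive.

Import Order.TTheory GRing.Theory Num.Theory.
Import numFieldNormedType.Exports.

Local Open Scope classical_set_scope.
Local Open Scope ring_scope.

(* Only the values on [0, 1[, which is mapped into itself, are meaningful. *)
Definition intermittent_map (R : realType) (alpha : R) (x : R) : R :=
  if x < 1 / 2 then x * (1 + 2 `^ alpha * x `^ alpha) else 2 * x - 1.

(* A probability measure on [0, 1[ is represented as a probability measure on
   the Borel sets of R that gives mass 1 to [0, 1[, whence the restriction to
   Borel subsets of [0, 1[ and the intersection of the preimage with [0, 1[. *)
Definition is_acip (R : realType) (T : R -> R)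
    (mu : probability (measurableTypeR R) R) : Prop :=
  [/\ mu `[0, 1[%classic = 1%E,
      mu `<< @lebesgue_measure R &
      forall A : set (measurableTypeR R), measurable A -> A `<=` `[0, 1[%classic ->
        mu (`[0, 1[%classic `&` T @^-1` A) = mu A].

(* The sum starts at the first iterate: phi (T x) + ... + phi (T^n x). *)
Definition birkhoff_sum (R : realType) (T : R -> R) (phi : R -> R)
    (n : nat) (x : R) : R :=
  \sum_(1 <= i < n.+1) phi (iter i T x).

(* Maximum over 0 <= i <= n - k, with n - k the integer difference. For
   nonnegative phi the default value 0 matters only when n < k, where the set
   of indices is empty. *)
Definition max_birkhoff_sum (R : realType) (T : R -> R) (phi : R -> R)
    (n k : nat) (x : R) : R :=
  \big[Num.max/0]_(0 <= i < n.+1 | (i + k <= n)%N)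
    birkhoff_sum T phi k (iter i T x).

Definition log2 (R : realType) (x : R) : R := ln x / ln 2.

(* Main.v *)
Require Import Defs.
From HB Require Import structures.
From mathcomp Require Import all_boot all_order all_algebra.
From mathcomp Require Import all_classical all_reals all_analysis.
From mathcomp Require Import measurable_realfun.
From mathcomp Require Import ring lra zify.

Set Implicit Arguments.
Unset Strict Implicit.
Unset Printing Implicit Defensive.

Import Order.TTheory GRing.Theory Num.Theory.
Import numFieldNormedType.Exports.

Local Open Scope classical_set_scope.
Local Open Scope ring_scope.

(** The upper bound is trivial, since a sum of [k] values of an indicator is at
    most [k].  For the lower bound it suffices to find, for almost every point,
    a block of almost [log2 n] consecutive visits to [[1/2, 1[] before time [n].
    Since [mu] is absolutely continuous, this only has to be proved for almost
    every point with respect to Lebesgue measure on [[0, 1[].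

    Distortion.  Fix a condition [P] on the first [n] binary digits of a point
    (digit [i] tells whether the [i]-th iterate is at least [1/2]) and let
    [G y] be the Lebesgue measure of the points satisfying [P] whose [n]-th
    iterate is below [y].  Then [G] is a convex function of [- 1 / y]
    ([strip_reciprocal_convex]).  This is proved by induction on [n]: the
    inverse branches of the map are themselves convex in the coordinate
    [- 1 / y], which for the branch at the neutral fixed point comes down to the
    concavity of [x `^ alpha] ([left_branch_slopes]).  Equivalently the density
    of the [n]-th iterate, multiplied by [y ^ 2], is nondecreasing, so that on
    [[1/2, 1[] its values at a point are at most four times those further
    right.  Hence, given the past and a visit to [[1/2, 1[], the iterate lies in
    [[1 - e, 1[] with probability at least [e] ([strip_right]) and in
    [[1/2, 1/2 + d[] with probability at most [4 d] ([strip_left]).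

    Waiting time for a run.  Points of [[1 - 2 ^- m, 1[] start a run of [m]
    visits, so each visit gives a run with probability at least [2 ^- m]; the
    expected number of visits before the first run is therefore at most
    [m 2 ^ m] ([sum_surv_right_le]).  An excursion to the left of [1/2] of
    length greater than [j] starts from a point at distance of order [1 / j]
    from [1/2] at most, hence has probability of order [1 / j]; summing over
    [j], time exceeds the number of visits by at most a logarithmic factor.
    By Markov's inequality the probability of seeing no run of length [m] up to
    time [2 ^ r] is of order [m (r + 1) 2 ^ (m - r)] ([surv_bound]).  With
    [m = r - 4 log2 (r + 2)] this is summable in [r], and the Borel-Cantelli
    lemma gives, almost surely, a run of length [m] before time [2 ^ r] for all
    large [r] ([lim_sup_late_run]).

    Conclusion.  For [2 ^ r <= n < 2 ^ (r + 1)], the hypothesis on [k] gives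
    [k n <= (1 + d) (r + 1)] for large [n], while the run has length
    [r - o(r)]; a window of length [k n] that overlaps the run as much as
    possible has the required average ([max_birkhoff_average_cvg]). *)

(** * Concavity of powers and the two branches *)

Section branches.
Context {R : realType} (alpha : R) (halpha : 0 < alpha < 1).
Local Notation T := (intermittent_map alpha).

(** Young's inequality for the exponents [1 / alpha] and [1 / (1 - alpha)], with
    one of the two factors equal to 1. *)
Lemma powR_le_tangent1 (u : R) : 0 <= u -> u `^ alpha <= 1 + alpha * (u - 1).
Proof.
case/andP: halpha => a0 a1 u0.
have b0 : 0 < 1 - alpha by rewrite subr_gt0.
have := @conjugate_powR R (u `^ alpha) 1 alpha^-1 (1 - alpha)^-1
  (powR_ge0 _ _) ler01.
rewrite !invr_gt0 !invrK => /(_ a0 b0).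
rewrite -powRrM mulfV ?gt_eqF// powRr1// powR1 mulr1 mul1r.
by move=> /(_ _)/le_trans; apply; lra.
Qed.

Lemma powR_le_tangent (x y : R) : 0 <= x -> 0 < y ->
  x `^ alpha <= y `^ alpha + alpha * (y `^ alpha / y) * (x - y).
Proof.
move=> x0 y0.
have -> : x `^ alpha = y `^ alpha * (x / y) `^ alpha.
  rewrite -powRM ?divr_ge0 ?(ltW y0)//.
  by rewrite mulrCA mulfV ?gt_eqF// mulr1.
have := powR_le_tangent1 (divr_ge0 x0 (ltW y0)).
move=> /(ler_wpM2l (powR_ge0 y alpha)) /le_trans; apply.
rewrite le_eqVlt; apply/orP; left; apply/eqP; field.
by rewrite gt_eqF.
Qed.

(** Both increments are compared with the tangent at the middle point. *)
Lemma powR_concave (x y z : R) : 0 <= x -> x < y -> y < z ->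
  (z `^ alpha - y `^ alpha) * (y - x) <= (y `^ alpha - x `^ alpha) * (z - y).
Proof.
move=> x0 xy yz.
have y0 : 0 < y := le_lt_trans x0 xy.
have := powR_le_tangent x0 y0.
have := powR_le_tangent (ltW (lt_trans y0 yz)) y0.
move: (alpha * _) => s.
move: (x `^ _) (y `^ _) (z `^ _) => a b c h1 h2.
have h3 : (c - b) * (y - x) <= (s * (z - y)) * (y - x).
  by apply: ler_wpM2r; lra.
have h4 : (s * (y - x)) * (z - y) <= (b - a) * (z - y).
  by apply: ler_wpM2r; lra.
by apply: le_trans h3 _; rewrite mulrAC.
Qed.

Definition left_branch (x : R) : R := x * (1 + 2 `^ alpha * x `^ alpha).

Lemma intermittent_left x : x < 1 / 2 -> T x = left_branch x.
Proof. by rewrite /intermittent_map => ->. Qed.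

Lemma intermittent_right x : 1 / 2 <= x -> T x = 2 * x - 1.
Proof. by rewrite /intermittent_map leNgt => /negbTE ->. Qed.

Lemma left_branch_half : left_branch (1 / 2) = 1.
Proof.
rewrite /left_branch -powRM// ?divr_ge0//.
by rewrite mulrA mulr1 mulfV ?pnatr_eq0// powR1; lra.
Qed.

Lemma left_branch_le (x y : R) : 0 <= x -> x <= y ->
  left_branch x <= left_branch y.
Proof.
case/andP: halpha => a0 a1 x0 xy.
have p : 2 `^ alpha * x `^ alpha <= 2 `^ alpha * y `^ alpha.
  apply: ler_wpM2l; first exact: powR_ge0.
  by apply: ge0_ler_powR; rewrite ?nnegrE ?(ltW a0)// (le_trans x0).
apply: ler_pM => //; first by rewrite addr_ge0// mulr_ge0// powR_ge0.
by rewrite lerD2l.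
Qed.

Lemma left_branch_lt (x y : R) : 0 <= x -> x < y ->
  left_branch x < left_branch y.
Proof.
case/andP: halpha => a0 a1 x0 xy.
have p : 2 `^ alpha * x `^ alpha <= 2 `^ alpha * y `^ alpha.
  apply: ler_wpM2l; first exact: powR_ge0.
  by apply: ge0_ler_powR; rewrite ?nnegrE ?(ltW a0)// ?(le_trans x0)// ltW.
have q : 0 <= 2 `^ alpha * x `^ alpha by rewrite mulr_ge0// powR_ge0.
rewrite /left_branch.
apply: (@le_lt_trans _ _ (x * (1 + 2 `^ alpha * y `^ alpha))).
  by apply: ler_wpM2l => //; lra.
by rewrite ltr_pM2r//; lra.
Qed.

Lemma left_branch_lt_cancel (x y : R) : 0 <= y ->
  left_branch x < left_branch y -> x < y.
Proof.
move=> y0; rewrite !ltNge => /negP h; apply/negP => /(left_branch_le y0).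
exact: h.
Qed.

Lemma left_branch_continuous : {within `[0, 1 / 2], continuous left_branch}.
Proof.
case/andP: halpha => a0 a1.
apply/continuous_within_itvP; first lra.
have pos x : 0 < x -> {for x, continuous left_branch}.
  move=> x0; apply: cvgM; first exact: cvg_id.
  apply: cvgD; first exact: cvg_cst.
  apply: cvgM; first exact: cvg_cst.
  have/differentiable_continuous // : differentiable (@powR R ^~ alpha) x.
  by apply/derivable1_diffP/derivable_powR; rewrite in_itv/= x0.
split.
- by move=> x; rewrite in_itv/= => /andP[x0 _]; exact: pos.
- rewrite {2}/left_branch; apply: cvgM; first exact: cvg_at_right_filter cvg_id.
  apply: cvgD; first exact: cvg_cst.
  apply: cvgM; first exact: cvg_cst.
  by rewrite powR0 ?gt_eqF//; exact: powR_cvg0.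
- by apply: cvg_at_left_filter; apply: pos; lra.
Qed.

Lemma left_branch_surj (y : R) : 0 < y <= 1 ->
  exists2 x, 0 < x <= 1 / 2 & left_branch x = y.
Proof.
case/andP=> y0 y1.
have f0 : left_branch 0 = 0 by rewrite /left_branch mul0r.
have [||x] := IVT (v := y) _ left_branch_continuous; first lra.
  by rewrite left_branch_half f0 /Order.min /Order.max ltr01 (ltW y0) y1.
rewrite in_itv/= => /andP[x0 x1] xy; exists x => //.
rewrite x1 andbT lt_neqAle x0 andbT; apply/eqP => x00.
by move: y0; rewrite -xy -x00 f0 ltxx.
Qed.

(** The inverse of the left branch is convex when source and target are both
    written in the coordinate [- 1 / x]: with denominators cleared, the
    inequality between its slopes on both sides of the middle point is this
    one.  For [left_branch x = x * (1 + t x)] it becomes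
    [(t Z - t Y) / ((Z - Y) (1 + t Z)) <= (t Y - t X) / ((Y - X) (1 + t X))],
    which holds because [t x = 2 `^ alpha * x `^ alpha] is concave and
    nondecreasing. *)
Lemma left_branch_slopes (X Y Z : R) : 0 < X -> X < Y -> Y < Z ->
  (Y - X) * (left_branch X * (Z * (left_branch Z - left_branch Y))) <=
  (Z - Y) * (left_branch Z * (X * (left_branch Y - left_branch X))).
Proof.
case/andP: halpha => a0 a1 X0 XY YZ; rewrite /left_branch.
have c0 : 0 <= 2 `^ alpha :> R by exact: powR_ge0.
have Y0 : 0 < Y by lra.
have Z0 : 0 < Z by lra.
have := ler_wpM2l c0 (powR_concave (ltW X0) XY YZ).
have pXY : 2 `^ alpha * X `^ alpha <= 2 `^ alpha * Y `^ alpha.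
  by apply: ler_wpM2l => //; apply: ge0_ler_powR; rewrite ?nnegrE; lra.
have pYZ : 2 `^ alpha * Y `^ alpha <= 2 `^ alpha * Z `^ alpha.
  by apply: ler_wpM2l => //; apply: ge0_ler_powR; rewrite ?nnegrE; lra.
have : 0 <= 2 `^ alpha * X `^ alpha by rewrite mulr_ge0// powR_ge0.
rewrite !(mulrA (2 `^ alpha)) !(mulrBr (2 `^ alpha)); move: pXY pYZ.
move: (2 `^ alpha * X `^ alpha) (2 `^ alpha * Y `^ alpha)
  (2 `^ alpha * Z `^ alpha) => a b c ab bc a00.
move=> conc.
have h1 : (1 + a) * ((c - b) * (Y - X)) <= (1 + c) * ((b - a) * (Z - Y)).
  apply: ler_pM => //; [lra| |lra].
  by rewrite mulr_ge0; lra.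
have h2 := ler_wpM2l (ltW (mulr_gt0 X0 (mulr_gt0 Y0 Z0))) h1.
lra.
Qed.

Lemma intermittent_bounds x : 0 <= x < 1 -> 0 <= T x < 1.
Proof.
case/andP=> x0 x1; have [xh|xh] := ltP x (1 / 2).
  rewrite intermittent_left//.
  rewrite -[X in _ && (_ < X)]left_branch_half left_branch_lt// andbT.
  by rewrite mulr_ge0// addr_ge0// mulr_ge0// powR_ge0.
by rewrite intermittent_right//; lra.
Qed.

Lemma iter_intermittent_bounds n x : 0 <= x < 1 -> 0 <= iter n T x < 1.
Proof. by move=> x01; elim: n => //= n; exact: intermittent_bounds. Qed.

Lemma measurable_intermittent :
  measurable_fun [set: measurableTypeR R] (T : measurableTypeR R -> measurableTypeR R).
Proof.
apply: measurable_fun_ifT => /=.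
- exact: measurable_fun_ltr.
- apply: measurable_funM => //; apply: measurable_funD => //.
  by apply: measurable_funM => //; exact: measurable_powR.
- by apply: measurable_funB => //; exact: measurable_funM.
Qed.

End branches.

(** * Lebesgue measure on the unit interval *)

Section unit_interval.
Context {R : realType}.
Implicit Types A B : set (measurableTypeR R).

(** Real-valued, so that measures can be subtracted from one another. *)
Definition leb01 A : R := fine (lebesgue_measure (A `&` `[0, 1[%classic)).

Lemma leb01E A : measurable A ->
  (leb01 A)%:E = lebesgue_measure (A `&` `[0, 1[%classic).
Proof.
move=> mA; rewrite fineK// ge0_fin_numE//.
apply: (@le_lt_trans _ _ (lebesgue_measure (`[0, 1[%classic : set R))).
  by apply: le_measure; rewrite ?inE//; apply: measurableI.
by rewrite lebesgue_measure_itv/= lte01 oppr0 adde0 ltry.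
Qed.

Lemma leb01_ge0 A : 0 <= leb01 A.
Proof. by rewrite fine_ge0. Qed.

Lemma leb01_le A B : measurable A -> measurable B ->
  (forall x, 0 <= x < 1 -> A x -> B x) -> leb01 A <= leb01 B.
Proof.
move=> mA mB AB; rewrite -lee_fin !leb01E//.
apply: le_measure; rewrite ?inE//; [exact: measurableI|exact: measurableI|].
by move=> x [Ax x01]; split => //; apply: AB => //; move: x01; rewrite /= in_itv.
Qed.

Lemma leb01_eq A B : (forall x, 0 <= x < 1 -> A x <-> B x) -> leb01 A = leb01 B.
Proof.
move=> AB; rewrite /leb01; congr (fine (lebesgue_measure _)).
apply/seteqP; split=> x [Ax x01]; split => //; apply/AB => //;
  by move: x01; rewrite /= in_itv.
Qed.

Lemma leb01U A B : measurable A -> measurable B ->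
  (forall x, A x -> B x -> False) -> leb01 (A `|` B) = leb01 A + leb01 B.
Proof.
move=> mA mB AB; apply: EFin_inj.
rewrite EFinD !leb01E//; last exact: measurableU.
rewrite setIUl measureU//; [exact: measurableI|exact: measurableI|].
by apply/seteqP; split=> // x [[Ax _] [Bx _]]; exact: (AB x).
Qed.

Lemma leb01_lt (y : R) : 0 <= y <= 1 -> leb01 [set x | x < y] = y.
Proof.
case/andP=> y0 y1; rewrite /leb01.
have -> : [set x | x < y] `&` `[0, 1[%classic = `[0, y[%classic :> set R.
  apply/seteqP; split=> x /=; rewrite !in_itv/=; first by case=> -> /andP[->].
  by move=> /andP[-> xy]; split => //; rewrite (lt_le_trans xy).
rewrite lebesgue_measure_itv/= lte_fin; case: ltP => h/=.
  by rewrite oppr0 addr0.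
by apply/eqP; rewrite eq_le y0.
Qed.

Lemma leb01_le1 A : measurable A -> leb01 A <= 1.
Proof.
move=> mA; rewrite -[leRHS](@leb01_lt 1) ?ler01 ?lexx//.
apply: leb01_le => //; last by move=> x /andP[].
by rewrite -[X in measurable X]setTI; apply: measurable_fun_ltr.
Qed.

End unit_interval.

(** * Distortion: convexity in the coordinate [- 1 / x] *)

Section reciprocal_convexity.
Context {R : realType}.
Implicit Types G H : R -> R.

(** The second clause says that [G] is convex as a function of [- 1 / x] on
    ]0, 1]: it compares the slopes on both sides of [y], with denominators
    cleared.  For smooth [G] it means that [x ^ 2 * G' x] is nondecreasing. *)
Definition reciprocal_convex G :=
  (forall x y, 0 < x -> x <= y -> y <= 1 -> G x <= G y) /\
  (forall x y z, 0 < x -> x < y -> y < z -> z <= 1 ->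
    (G y - G x) * (x * (z - y)) <= (G z - G y) * (z * (y - x))).

Lemma reciprocal_convex_linear G (c : R) : 0 <= c ->
  (forall y, 0 < y <= 1 -> G y = c * y) -> reciprocal_convex G.
Proof.
move=> c0 Gc; split=> [x y x0 xy y1|x y z x0 xy yz z1].
  by rewrite !Gc; [rewrite ler_wpM2l|lra..].
rewrite !Gc; [|lra..].
rewrite [leLHS](_ : _ = x * (c * ((y - x) * (z - y)))); last by ring.
rewrite [leRHS](_ : _ = z * (c * ((y - x) * (z - y)))); last by ring.
by apply: ler_wpM2r; [rewrite !mulr_ge0//; lra|lra].
Qed.

Lemma reciprocal_convexD G H K : reciprocal_convex G -> reciprocal_convex H ->
  (forall y, 0 < y <= 1 -> K y = G y + H y) -> reciprocal_convex K.
Proof.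
move=> [G1 G2] [H1 H2] KGH; split=> [x y x0 xy y1|x y z x0 xy yz z1].
  by rewrite !KGH; [rewrite lerD// (G1, H1)|lra..].
rewrite !KGH; [|lra..].
have := lerD (G2 _ _ _ x0 xy yz z1) (H2 _ _ _ x0 xy yz z1).
lra.
Qed.

(** A nondecreasing convex function composed with a convex function is convex;
    the hypothesis on the slopes of [f] is convexity of [f] when source and
    target are both written in the coordinate [- 1 / x]. *)
Lemma reciprocal_convex_comp G H (f : R -> R) (c : R) : reciprocal_convex G ->
  (forall x, 0 < x <= 1 -> 0 < f x <= 1) ->
  (forall x y, 0 < x -> x < y -> y <= 1 -> f x < f y) ->
  (forall x y z, 0 < x -> x < y -> y < z -> z <= 1 ->
    (f y - f x) * (x * (f z * (z - y))) <= (f z - f y) * (z * (f x * (y - x)))) ->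
  (forall y, 0 < y <= 1 -> H y = G (f y) - c) ->
  reciprocal_convex H.
Proof.
move=> [G1 G2] f01 flt fconv HG; split=> [x y x0|x y z x0 xy yz z1].
  rewrite le_eqVlt => /predU1P[->//|xy] y1.
  rewrite !HG; [|lra..]; rewrite lerD2r; apply: G1.
  - by have /andP[] := f01 x ltac:(lra).
  - by rewrite ltW// flt.
  - by have /andP[] := f01 y ltac:(lra).
have /andP[X0 X1] := f01 x ltac:(lra).
have /andP[Z0 Z1] := f01 z ltac:(lra).
have XY := flt x y x0 xy ltac:(lra).
have YZ := flt y z ltac:(lra) yz z1.
have := G2 _ _ _ X0 XY YZ Z1.
have := G1 _ _ (lt_trans X0 XY) (ltW YZ) Z1.
have := fconv _ _ _ x0 xy yz z1.
rewrite !HG; [|lra..].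
have shift u v : u - c - (v - c) = u - v by ring.
rewrite !shift.
move: (f x) (f y) (f z) X0 XY YZ {X1 Z1} Z0 => X Y Z X0 XY YZ Z0.
move: (G X) (G Y) (G Z) => a b d hf bd hG.
have k : 0 < X * (Z - Y) by rewrite mulr_gt0// subr_gt0.
have h1 : 0 <= Z * (x * (z - y)) by rewrite !mulr_ge0//; lra.
have h2 := ler_wpM2r h1 hG.
have h3 : 0 <= d - b by lra.
have h4 := ler_wpM2l h3 hf.
have kZ : 0 < Z * (X * (Z - Y)) by rewrite mulr_gt0.
rewrite -(ler_pM2r kZ).
have -> : (b - a) * (x * (z - y)) * (Z * (X * (Z - Y))) =
  (b - a) * (X * (Z - Y)) * (Z * (x * (z - y))) by ring.
apply: le_trans h2 _.
have -> : (d - b) * (Z * (Y - X)) * (Z * (x * (z - y))) =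
  Z * ((d - b) * ((Y - X) * (x * (Z * (z - y))))) by ring.
have -> : (d - b) * (z * (y - x)) * (Z * (X * (Z - Y))) =
  Z * ((d - b) * ((Z - Y) * (z * (X * (y - x))))) by ring.
by rewrite ler_pM2l.
Qed.

(** The slope inequality at [1 / 2 < 1 - e < 1].  The density may decrease, but
    not faster than [1 / x ^ 2]. *)
Lemma reciprocal_convex_right G (e : R) : reciprocal_convex G -> 0 < e <= 1 / 2 ->
  e * (G 1 - G (1 / 2)) <= G 1 - G (1 - e).
Proof.
move=> [G1 G2] /andP[e0]; rewrite le_eqVlt => /predU1P[->|e1].
  have -> : 1 - 1 / 2 = 1 / 2 :> R by lra.
  have := G1 (1 / 2) 1 ltac:(lra) ltac:(lra) ltac:(lra); lra.
have := G2 (1 / 2) (1 - e) 1 ltac:(lra) ltac:(lra) ltac:(lra) ltac:(lra).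
have := G1 (1 - e) 1 ltac:(lra) ltac:(lra) ltac:(lra).
move: (G 1) (G (1 - e)) (G (1 / 2)) => a b c ab h.
have : 0 <= e * (a - b) by rewrite mulr_ge0//; lra.
lra.
Qed.

(** The slope inequality at [1 / 2 < 1 / 2 + d < 1]. *)
Lemma reciprocal_convex_left G (d : R) : reciprocal_convex G -> 0 < d <= 1 / 2 ->
  G (1 / 2 + d) - G (1 / 2) <= 4 * d * (G 1 - G (1 / 2)).
Proof.
move=> [G1 G2] /andP[d0]; rewrite le_eqVlt => /predU1P[->|d1].
  have -> : 1 / 2 + 1 / 2 = 1 :> R by lra.
  have := G1 (1 / 2) 1 ltac:(lra) ltac:(lra) ltac:(lra); lra.
have := G2 (1 / 2) (1 / 2 + d) 1 ltac:(lra) ltac:(lra) ltac:(lra) ltac:(lra).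
have := G1 (1 / 2) (1 / 2 + d) ltac:(lra) ltac:(lra) ltac:(lra).
move: (G 1) (G (1 / 2 + d)) (G (1 / 2)) => a b c cb h.
have : 0 <= d * (b - c) by rewrite mulr_ge0//; lra.
lra.
Qed.

End reciprocal_convexity.

(** * Itineraries and bounded distortion *)

Section itineraries.
Context {R : realType} (alpha : R) (halpha : 0 < alpha < 1).
Local Notation T := (intermittent_map alpha).
Implicit Types P : pred (seq bool).

Definition itinerary n (x : R) : seq bool :=
  [seq 1 / 2 <= iter i T x | i <- iota 0 n].

Lemma itineraryS n x :
  itinerary n.+1 x = rcons (itinerary n x) (1 / 2 <= iter n T x).
Proof. by rewrite /itinerary -[in LHS](addn1 n) iotaD map_cat cats1. Qed.

Lemma itineraryD n m x :
  itinerary (n + m) x = itinerary n x ++ itinerary m (iter n T x).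
Proof.
rewrite /itinerary iotaD map_cat add0n -{2}[n]addn0 iotaDl -map_comp.
by congr (_ ++ _); apply: eq_map => i /=; rewrite addnC iterD.
Qed.

Lemma measurable_iter_intermittent n : measurable_fun [set: measurableTypeR R]
  (iter n T : measurableTypeR R -> measurableTypeR R).
Proof.
elim: n => [|n IH]; first exact: measurable_id.
by apply: measurableT_comp IH; exact: measurable_intermittent.
Qed.

Lemma measurable_iter_lt n y :
  measurable ([set x | iter n T x < y] : set (measurableTypeR R)).
Proof.
rewrite -[X in measurable X]setTI.
apply: (measurable_fun_ltr (measurable_iter_intermittent n)
  (measurable_cst y)) => //.
Qed.

Lemma measurable_iter_ge n y :
  measurable ([set x | y <= iter n T x] : set (measurableTypeR R)).
Proof.
rewrite (_ : mkset _ = ~` [set x | iter n T x < y]); last first.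
  by apply/seteqP; split=> x /=; rewrite leNgt => /negP.
by apply: measurableC; exact: measurable_iter_lt.
Qed.

Lemma measurable_itinerary P n :
  measurable ([set x | P (itinerary n x)] : set (measurableTypeR R)).
Proof.
elim: n P => [|n IH] P.
  rewrite /itinerary/=; case: (P [::]).
    by rewrite (_ : mkset _ = setT)//; apply/seteqP; split.
  by rewrite (_ : mkset _ = set0)//; apply/seteqP; split.
rewrite (_ : mkset _ =
  ([set x | P (rcons (itinerary n x) false)] `&` [set x | iter n T x < 1 / 2]) `|`
  ([set x | P (rcons (itinerary n x) true)] `&` [set x | 1 / 2 <= iter n T x])).
  apply: measurableU; apply: measurableI.
  - exact: (IH (fun s => P (rcons s false))).
  - exact: measurable_iter_lt.
  - exact: (IH (fun s => P (rcons s true))).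
  - exact: measurable_iter_ge.
apply/seteqP; split=> x /=; rewrite itineraryS; case: (leP (1 / 2)) => h; auto.
- by case=> [[]|[]].
- by case=> [[]|[]].
Qed.

(** For fixed [P] and [n] this is, as a function of [a] and [b], the
    distribution of the [n]-th iterate of a uniform point on the event that its
    first [n] digits satisfy [P]. *)
Definition strip P n (a b : R) : R :=
  leb01 [set x | P (itinerary n x) /\ a <= iter n T x < b].

Lemma measurable_strip P n a b :
  measurable ([set x | P (itinerary n x) /\ a <= iter n T x < b] :
    set (measurableTypeR R)).
Proof.
rewrite (_ : mkset _ = [set x | P (itinerary n x)] `&`
  ([set x | a <= iter n T x] `&` [set x | iter n T x < b])); last first.
  by apply/seteqP; split=> x /= [Px]; [move=> /andP[]|case=> -> ->].
apply: measurableI; first exact: measurable_itinerary.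
by apply: measurableI; [exact: measurable_iter_ge|exact: measurable_iter_lt].
Qed.

Lemma strip_ge0 P n a b : 0 <= strip P n a b.
Proof. exact: leb01_ge0. Qed.

Lemma strip_cat P n a b c : a <= b -> b <= c ->
  strip P n a c = strip P n a b + strip P n b c.
Proof.
move=> ab bc; rewrite /strip -leb01U; [|exact: measurable_strip..|].
  apply: leb01_eq => x _ /=; split=> [[Px /andP[ax xc]]|].
    case: (ltP (iter n T x) b) => h; [left|right]; split => //; lra.
  by case=> [[Px h]|[Px h]]; split => //; lra.
by move=> x [_ h] [_ k]; lra.
Qed.

(** The two preimages of [0, y[, one on each branch; the point [y] is given
    through its preimage [X] so as not to need an inverse function. *)
Lemma strip_step P n (X : R) : 0 < X <= 1 / 2 ->
  strip P n.+1 0 (left_branch alpha X) =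
  strip (fun s => P (rcons s false)) n 0 X +
  strip (fun s => P (rcons s true)) n (1 / 2) ((1 + left_branch alpha X) / 2).
Proof.
case/andP=> X0 X1.
rewrite /strip -leb01U; last first.
  - by move=> x [_ h] [_ k]; lra.
  - exact: (measurable_strip (fun s => P (rcons s true))).
  - exact: (measurable_strip (fun s => P (rcons s false))).
apply: leb01_eq => x x01 /=; rewrite itineraryS.
have /andP[i0 i1] := iter_intermittent_bounds halpha n x01.
have /andP[-> _] := iter_intermittent_bounds halpha n.+1 x01.
move: (iter n T x) i0 i1 => y y0 y1 /=.
case: (leP (1 / 2) y) => h; split.
- move=> [Px]; rewrite intermittent_right// => k; right; split => //; lra.
- case=> [[_ k]|[Px k]]; first lra.
  by split=> //; rewrite intermittent_right//; lra.
- move=> [Px]; rewrite intermittent_left// => k; left; split => //.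
  by rewrite y0/=; apply: (left_branch_lt_cancel halpha _ k); rewrite ltW.
- case=> [[Px k]|[_ k]]; last lra.
  by split=> //; rewrite intermittent_left// left_branch_lt//; lra.
Qed.

(** Bounded distortion, uniformly in the time [n] and the condition [P] on the
    past: appending a digit composes with an inverse branch, and summing over
    the two values of the digit preserves convexity. *)
Lemma strip_reciprocal_convex P n : reciprocal_convex (strip P n 0).
Proof.
elim: n P => [|n IH] P.
  apply: (@reciprocal_convex_linear _ _ (P [::])%:R) => // y y01.
  case: (boolP (P [::])) => P0.
    rewrite mul1r -[RHS]leb01_lt; last lra.
    apply: leb01_eq => x /andP[x0 _] /=.
    by split=> [[_ /andP[]]|->]//; rewrite x0.
  rewrite mul0r /strip -[RHS](@leb01_lt _ 0); last lra.
  apply: leb01_eq => x /andP[x0 _] /=; split; first by case=> /(negP P0).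
  by rewrite ltNge x0.
(* [f] inverts the left branch on ]0, 1]. *)
have /choice[f Hf] : forall y : R, exists x, 0 < y <= 1 ->
    0 < x <= 1 / 2 /\ left_branch alpha x = y.
  move=> y; case: (boolP (0 < y <= 1)) => [/(left_branch_surj halpha)[x x0 xy]|//].
    by exists x.
  by exists 0.
apply: (@reciprocal_convexD _
  (fun y => strip (fun s => P (rcons s false)) n 0 (f y))
  (fun y => strip (fun s => P (rcons s true)) n (1 / 2) ((1 + y) / 2))).
- apply: (reciprocal_convex_comp (f := f) (c := 0)
    (IH (fun s => P (rcons s false)))) => [x x01|x y x0 xy y1|x y z x0 xy yz z1|y _].
  + by have [fx _] := Hf x x01; lra.
  + have [fx ex] := Hf x ltac:(lra); have [fy ey] := Hf y ltac:(lra).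
    by apply: (left_branch_lt_cancel halpha); [lra|rewrite ex ey].
  + have [fx ex] := Hf x ltac:(lra); have [fy ey] := Hf y ltac:(lra).
    have [fz ez] := Hf z ltac:(lra).
    have XY : f x < f y by apply: (left_branch_lt_cancel halpha); rewrite ?ex ?ey; lra.
    have YZ : f y < f z by apply: (left_branch_lt_cancel halpha); rewrite ?ey ?ez; lra.
    have := left_branch_slopes halpha (proj1 (andP fx)) XY YZ.
    by rewrite ex ey ez.
  + by rewrite subr0.
- apply: (reciprocal_convex_comp (f := fun y => (1 + y) / 2)
    (c := strip (fun s => P (rcons s true)) n 0 (1 / 2))
    (IH (fun s => P (rcons s true))))
    => [x x01|x y x0 xy y1|x y z x0 xy yz z1|y y01]; [lra|lra| |].
  + have h : 0 <= (y - x) * (z - y) by rewrite mulr_ge0; lra.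
    have h1 : 0 <= (z - x) * ((y - x) * (z - y)) by rewrite mulr_ge0; lra.
    lra.
  + have := @strip_cat (fun s => P (rcons s true)) n 0 (1 / 2) ((1 + y) / 2)
      ltac:(lra) ltac:(lra).
    by move=> ->; rewrite addrAC subrr add0r.
- move=> y y01; have [fy ey] := Hf y y01.
  by rewrite -{1 3}ey strip_step.
Qed.

Lemma stripB P n (a b : R) : 0 <= a -> a <= b ->
  strip P n a b = strip P n 0 b - strip P n 0 a.
Proof. by move=> a0 ab; rewrite (strip_cat P n a0 ab) addrAC subrr add0r. Qed.

Lemma strip_right P n (e : R) : 0 < e <= 1 / 2 ->
  e * strip P n (1 / 2) 1 <= strip P n (1 - e) 1.
Proof.
move=> e01; rewrite (@stripB P n (1 / 2)) ?(@stripB P n (1 - e)); [|lra..].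
exact: reciprocal_convex_right (strip_reciprocal_convex P n) e01.
Qed.

Lemma strip_left P n (d : R) : 0 < d <= 1 / 2 ->
  strip P n (1 / 2) (1 / 2 + d) <= 4 * d * strip P n (1 / 2) 1.
Proof.
move=> d01; rewrite !(@stripB P n (1 / 2)); [|lra..].
exact: reciprocal_convex_left (strip_reciprocal_convex P n) d01.
Qed.

End itineraries.

(** * Expected waiting time for a run of visits to [1 / 2, 1[ *)

Section waiting_time.
Context {R : realType} (alpha : R) (halpha : 0 < alpha < 1).
Local Notation T := (intermittent_map alpha).

Definition no_run m : pred (seq bool) := fun s => ~~ infix (nseq m true) s.

Definition surv m n : R := strip alpha (no_run m) n 0 1.

Definition surv_right m n : R := strip alpha (no_run m) n (1 / 2) 1.

Lemma surv_le1 m n : surv m n <= 1.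
Proof. by apply: leb01_le1; exact: measurable_strip. Qed.

Lemma no_run_cat m s t : no_run m (s ++ t) -> no_run m s.
Proof. by apply: contra; exact: infix_catr. Qed.

Lemma surv_anti m n : surv m n.+1 <= surv m n.
Proof.
apply: leb01_le; [exact: measurable_strip..|move=> x x01 /=].
rewrite itineraryS -cats1 => -[/no_run_cat nr _]; split => //.
exact: iter_intermittent_bounds.
Qed.

Lemma itinerary_near1 m (y : R) :
  1 - (2 ^+ m)^-1 <= y < 1 -> itinerary alpha m y = nseq m true.
Proof.
elim: m y => // m IH y /andP[y0 y1].
have p : 0 < (2 ^+ m)^-1 :> R by rewrite invr_gt0 exprn_gt0.
have p1 : (2 ^+ m)^-1 <= 1 :> R.
  by rewrite invf_le1 ?exprn_gt0// exprn_ege1// ler1n.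
rewrite exprS invfM in y0.
have h : 1 / 2 <= y by lra.
rewrite -add1n itineraryD /= h IH// intermittent_right//; lra.
Qed.

(** By the distortion bound, a visit to [1 / 2, 1[ lies in [1 - 2 ^- m, 1[ with
    conditional probability at least [2 ^- m].  From there the next [m] digits
    are all 1, so a point surviving at time [n] no longer does at time
    [n + m]. *)
Lemma surv_right_le m n :
  surv_right m n <= 2 ^+ m * (surv m n - surv m (n + m)).
Proof.
case: m => [|m].
  rewrite addn0 subrr mulr0 /surv_right -[leRHS](@leb01_lt R 0); last lra.
  apply: leb01_le; [exact: measurable_strip|exact: (measurable_iter_lt alpha 0)|].
  by move=> x _ /= [] /negP; rewrite infix0s.
set e : R := (2 ^+ m.+1)^-1.
have e0 : 0 < e by rewrite invr_gt0 exprn_gt0.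
have e1 : e <= 1 / 2.
  rewrite /e exprS invfM ler_pdivlMr// mulrAC mulVf ?mul1r ?pnatr_eq0//.
  by rewrite invf_le1 ?exprn_gt0// exprn_ege1// ler1n.
rewrite -ler_pdivrMl ?exprn_gt0// -/e.
apply: (le_trans (strip_right halpha (no_run m.+1) n (e := e) _)); first lra.
rewrite lerBrDr /surv /strip -leb01U; [|exact: measurable_strip..|].
- apply: leb01_le; [|exact: measurable_strip|].
    by apply: measurableU; exact: measurable_strip.
  move=> x x01 [[nr _]|[nr _]] /=.
    by split=> //; exact: iter_intermittent_bounds.
  split; last exact: iter_intermittent_bounds.
  by move: nr; rewrite itineraryD; exact: no_run_cat.
- move=> x [_ /itinerary_near1 h] [+ _].
  by rewrite /no_run itineraryD h infix_catl// infix_refl.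
Qed.

(** The sum of the differences in [surv_right_le] telescopes with step [m], and
    leaves at most [m] terms that are at most 1. *)
Lemma sum_surv_right_le m N :
  \sum_(n < N) surv_right m n <= m%:R * 2 ^+ m.
Proof.
apply: (@le_trans _ _ (\sum_(n < N) 2 ^+ m * (surv m n - surv m (n + m)))).
  by apply: ler_sum => n _; exact: surv_right_le.
rewrite -big_distrr/= mulrC ler_wpM2r ?exprn_ge0//.
rewrite big_split/= sumrN lerBlDr.
have h1 : \sum_(i < N + m) surv m i =
    \sum_(i < N) surv m i + \sum_(i < m) surv m (N + i) by rewrite big_split_ord.
have h2 : \sum_(i < m + N) surv m i =
    \sum_(i < m) surv m i + \sum_(i < N) surv m (i + m).
  by rewrite big_split_ord/=; congr (_ + _); apply: eq_bigr => i _; rewrite addnC.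
have h3 : 0 <= \sum_(i < m) surv m (N + i).
  by apply: sumr_ge0 => i _; exact: strip_ge0.
have h4 : \sum_(i < m) surv m i <= m%:R.
  rewrite -[m in leRHS]card_ord -sumr_const; apply: ler_sum => i _.
  exact: surv_le1.
rewrite addnC in h2; lra.
Qed.

(** The interval [0, 1 / (j + 1)[ pulls back along the left branch into
    [0, 1 / (j + 2)[.  For [0 < u <= 1] one has [u <= u `^ alpha], so it suffices
    to check the quadratic map [x * (1 + 2 * x)]. *)
Lemma left_branch_inv (j : nat) :
  (j.+1%:R)^-1 <= left_branch alpha (j.+2%:R)^-1.
Proof.
case/andP: halpha => a0 a1; rewrite /left_branch -powRM ?invr_ge0//.
have j2 : 0 < j.+2%:R :> R by rewrite ltr0n.
have j1 : 0 < j.+1%:R :> R by rewrite ltr0n.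
have h : 2 / j.+2%:R <= (2 / j.+2%:R) `^ alpha.
  apply: ger1_powR; last exact: ltW.
  by rewrite divr_gt0//= ler_pdivrMr// mul1r ler_nat.
apply: (@le_trans _ _ (j.+2%:R^-1 * (1 + 2 / j.+2%:R))).
  rewrite -subr_ge0.
  have e2 : j.+2%:R = j%:R + 2 :> R by rewrite -addn2 natrD.
  have e1 : j.+1%:R = j%:R + 1 :> R by rewrite -addn1 natrD.
  rewrite [leRHS](_ : _ = j%:R / (j.+2%:R * j.+2%:R * j.+1%:R)).
    by rewrite divr_ge0// !mulr_ge0.
  by rewrite e2 e1; field; rewrite -e2 -e1 !gt_eqF.
by rewrite ler_wpM2l ?invr_ge0// lerD2l.
Qed.

(** A point of [0, 1 / (j + 1)[ has its predecessor either below [1 / (j + 2)],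
    by [left_branch_inv], or within [1 / (2 (j + 1))] to the right of [1 / 2];
    the second possibility is rare among the visits by the distortion bound. *)
Lemma surv_low_step m n j :
  strip alpha (no_run m) n.+1 0 (j.+1%:R)^-1 <=
  strip alpha (no_run m) n 0 (j.+2%:R)^-1 + 2 / j.+1%:R * surv_right m n.
Proof.
set a : R := (j.+1%:R)^-1; set b : R := (j.+2%:R)^-1.
have a01 : 0 < a <= 1.
  by rewrite /a invr_gt0 ltr0n/= invf_le1 ?ltr0n// ler1n.
have b01 : 0 < b <= 1 / 2.
  by rewrite /b invr_gt0 ltr0n/= div1r lef_pV2 ?posrE ?ltr0n// ler_nat.
apply: (@le_trans _ _ (strip alpha (no_run m) n 0 b +
    strip alpha (no_run m) n (1 / 2) (1 / 2 + a / 2))); last first.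
  rewrite lerD2l; have := strip_left halpha (no_run m) n (d := a / 2) ltac:(lra).
  by rewrite /surv_right -/a; lra.
rewrite /strip -leb01U; [|exact: measurable_strip..|]; last first.
  by move=> x [_ h] [_ k]; lra.
apply: leb01_le; [exact: measurable_strip| |].
  by apply: measurableU; exact: measurable_strip.
move=> x x01 /= []; rewrite itineraryS -cats1 => /no_run_cat nr.
have := iter_intermittent_bounds halpha n x01.
move: (iter n T x) => y /andP[y0 y1]; case: (leP (1 / 2) y) => yh.
  by rewrite intermittent_right// => h; right; split=> //; lra.
rewrite intermittent_left// => /andP[_ h]; left; split=> //; rewrite y0/=.
apply: (left_branch_lt_cancel halpha); first lra.
exact: lt_le_trans h (left_branch_inv j).
Qed.

(** Iterating [surv_low_step], the time spent in [0, 1 / (j + 1)[ is at most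
    the number of visits to [1 / 2, 1[ times a harmonic sum.  The induction on
    [N] replaces [j] by [j + 1], whence the general [j]. *)
Lemma sum_surv_low m N j :
  \sum_(n < N) strip alpha (no_run m) n.+1 0 (j.+1%:R)^-1 <=
  (2 * (m%:R * 2 ^+ m) + 1) * \sum_(l < N) ((j + l).+1%:R)^-1.
Proof.
set V : R := m%:R * 2 ^+ m.
have V0 : 0 <= V by rewrite mulr_ge0// exprn_ge0.
elim: N j => [|N IH] j; first by rewrite !big_ord0 mulr0.
have step : \sum_(n < N.+1) strip alpha (no_run m) n.+1 0 (j.+1%:R)^-1 <=
    \sum_(n < N.+1) strip alpha (no_run m) n 0 (j.+2%:R)^-1 + 2 / j.+1%:R * V.
  apply: (@le_trans _ _ (\sum_(n < N.+1) (strip alpha (no_run m) n 0 (j.+2%:R)^-1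
      + 2 / j.+1%:R * surv_right m n))).
    by apply: ler_sum => n _; exact: surv_low_step.
  rewrite big_split/= lerD2l -big_distrr/= ler_wpM2l ?divr_ge0//.
  exact: sum_surv_right_le.
apply: (le_trans step).
have h0 : strip alpha (no_run m) 0 0 (j.+2%:R)^-1 <= (j.+1%:R)^-1.
  set b : R := (j.+2%:R)^-1; have b01 : 0 <= b <= 1.
    by rewrite /b invr_ge0 ler0n/= invf_le1 ?ltr0n// ler1n.
  apply: (@le_trans _ _ b).
    rewrite -[leRHS](leb01_lt b01).
    apply: leb01_le; [exact: measurable_strip|exact: (measurable_iter_lt alpha 0)|].
    by move=> x _ [_ /andP[]].
  by rewrite lef_pV2 ?posrE ?ltr0n// ler_nat.
have -> : \sum_(n < N.+1) strip alpha (no_run m) n 0 (j.+2%:R)^-1 =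
    strip alpha (no_run m) 0 0 (j.+2%:R)^-1 +
    \sum_(n < N) strip alpha (no_run m) n.+1 0 (j.+2%:R)^-1.
  by rewrite big_ord_recl; congr (_ + _); apply: eq_bigr.
have -> : \sum_(l < N.+1) ((j + l).+1%:R)^-1 =
    (j.+1%:R)^-1 + \sum_(l < N) ((j.+1 + l).+1%:R)^-1 :> R.
  rewrite big_ord_recl addn0; congr (_ + _); apply: eq_bigr => l _.
  by rewrite /bump/= addnA addn1.
move: (IH j.+1) h0; move: (strip _ _ 0 _ _) => s.
move: (\sum_(n < N) _) => A; move: (\sum_(l < N) _) => B.
move: (j.+1%:R^-1) => a h1 h2; lra.
Qed.

(** Each dyadic block of the harmonic series contributes at most 1. *)
Lemma harmonic_pow2 r : \sum_(l < 2 ^ r) (l.+1%:R)^-1 <= r.+1%:R :> R.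
Proof.
elim: r => [|r IH]; first by rewrite big_ord1 invr1.
rewrite expnS mul2n -addnn big_split_ord/= -[r.+2]addn1 natrD lerD//.
apply: (@le_trans _ _ (\sum_(i < 2 ^ r) ((2 ^ r)%:R)^-1)).
  apply: ler_sum => i _; rewrite lef_pV2 ?posrE ?ltr0n ?expn_gt0//.
  by rewrite ler_nat ltnW// ltnS leq_addr.
by rewrite sumr_const card_ord -[leLHS]mulr_natl mulfV// pnatr_eq0 -lt0n expn_gt0.
Qed.

(** Markov's inequality for the time of the first run: survival is
    nonincreasing in time, and its sum over time is controlled by
    [sum_surv_low] with [j = 0]. *)
Lemma surv_bound m r :
  (2 ^ r)%:R * surv m (2 ^ r) <= (2 * (m%:R * 2 ^+ m) + 1) * r.+1%:R.
Proof.
apply: (@le_trans _ _ (\sum_(n < 2 ^ r) surv m n.+1)).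
  rewrite -[X in X%:R * _]card_ord mulr_natl -sumr_const.
  apply: ler_sum => n _.
  have anti := @homo_leq _ (surv m) (fun x y => y <= x) (fun x => lexx x)
    (fun y x z h1 h2 => le_trans h2 h1) (surv_anti m).
  exact: anti.
have := sum_surv_low m (2 ^ r) 0; rewrite invr1 => /le_trans; apply.
by rewrite ler_wpM2l ?harmonic_pow2// addr_ge0// !mulr_ge0// exprn_ge0.
Qed.

End waiting_time.

(** * Almost surely, long runs appear early *)

(** The logarithmic correction makes the probability of no such run before time
    [2 ^ r] summable in [r], while keeping the length equivalent to [r]. *)
Definition run_length (r : nat) : nat := r - 4 * up_log 2 r.+2.

Section almost_sure_runs.
Context {R : realType} (alpha : R) (halpha : 0 < alpha < 1).
Local Notation T := (intermittent_map alpha).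

Lemma surv0 n : surv alpha 0 n = 0.
Proof.
apply/eqP; rewrite eq_le strip_ge0 andbT -[leRHS](@leb01_lt R 0); last lra.
apply: leb01_le; [exact: measurable_strip|exact: (measurable_iter_lt alpha 0)|].
by move=> x _ /= [] /negP; rewrite infix0s.
Qed.

(** The bound [surv_bound] is of order [(r + 1) ^ 2 / 2 ^ (4 u)] with
    [2 ^ u >= r + 2]; the right-hand side is chosen to telescope. *)
Lemma surv_run_length_le r :
  surv alpha (run_length r) (2 ^ r) <= 3 / (r.+1%:R * r.+2%:R).
Proof.
have [r4|r4] := leqP r (4 * up_log 2 r.+2).
  have -> : run_length r = 0%N by apply/eqP; rewrite subn_eq0.
  by rewrite surv0 divr_ge0// mulr_ge0.
have := surv_bound halpha (run_length r) r.
set m := run_length r; set s := surv _ _ _.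
have s0 : 0 <= s by exact: strip_ge0.
pose q : R := 2 ^+ up_log 2 r.+2; pose p : R := r.+1%:R.
have p1 : 1 <= p by rewrite ler1n.
have p2 : r.+2%:R = p + 1 by rewrite /p -[in RHS]natr1 -natr1 -natr1.
have pq : p + 1 <= q by rewrite -p2 /q -natrX ler_nat; exact: up_logP.
have -> : (2 ^ r)%:R = 2 ^+ m * q ^+ 4.
  by rewrite natrX -exprM -exprD; congr (_ ^+ _); rewrite /m /run_length; lia.
have mp : m%:R + 1 <= p by rewrite /p natr1 ler_nat ltnS leq_subr.
have M1 : 1 <= 2 ^+ m :> R by rewrite exprn_ege1// ler1n.
rewrite p2 -/p; clearbody p q; move: (2 ^+ m) M1 => M M1 bound.
have h1 : q ^+ 4 * s <= 3 * p * p.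
  rewrite -(ler_pM2l (lt_le_trans ltr01 M1)) mulrA.
  apply: (le_trans bound).
  have -> : M * (3 * p * p) = (3 * (p * M)) * p by ring.
  rewrite ler_wpM2r//; first lra.
  have : (m%:R + 1) * M <= p * M by rewrite ler_wpM2r//; lra.
  have : 1 * M <= p * M by rewrite ler_wpM2r//; lra.
  lra.
have h2 : (p + 1) ^+ 4 * s <= 3 * p * p.
  apply: le_trans h1; rewrite ler_wpM2r//.
  by apply: lerXn2r; rewrite ?nnegrE//; lra.
have pp : 0 < p * (p + 1) by rewrite mulr_gt0//; lra.
rewrite ler_pdivlMr//.
have p3 : 0 < (p + 1) ^+ 3 by rewrite exprn_gt0//; lra.
rewrite -(ler_pM2r p3).
have -> : s * (p * (p + 1)) * (p + 1) ^+ 3 = p * ((p + 1) ^+ 4 * s) by ring.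
apply: (@le_trans _ _ (p * (3 * p * p))); first by rewrite ler_wpM2l//; lra.
have -> : p * (3 * p * p) = 3 * p ^+ 3 by ring.
by rewrite ler_wpM2l//; apply: lerXn2r; rewrite ?nnegrE; lra.
Qed.

Lemma sum_inv_consecutive n :
  \sum_(r < n) 3 / (r.+1%:R * r.+2%:R) = 3 - 3 / n.+1%:R :> R.
Proof.
elim: n => [|n IH]; first by rewrite big_ord0 divr1 subrr.
rewrite big_ord_recr/= IH.
have e1 : n.+1%:R = n%:R + 1 :> R by rewrite -addn1 natrD.
have e2 : n.+2%:R = n%:R + 2 :> R by rewrite -addn2 natrD.
by rewrite e1 e2; field; rewrite -e1 -e2 !pnatr_eq0.
Qed.

Definition late_run (r : nat) : set (measurableTypeR R) :=
  [set x | no_run (run_length r) (itinerary alpha (2 ^ r) x) /\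
           0 <= iter (2 ^ r) T x < 1] `&` `[0, 1[%classic.

Lemma measurable_late_run r : measurable (late_run r).
Proof. by apply: measurableI; first exact: measurable_strip. Qed.

Lemma lim_sup_late_run : lebesgue_measure (lim_sup_set late_run) = 0%E.
Proof.
apply: lim_sup_set_cvg0; first exact: measurable_late_run.
have leb r : lebesgue_measure (late_run r) =
    (surv alpha (run_length r) (2 ^ r))%:E.
  by rewrite /surv /strip leb01E//; exact: measurable_strip.
apply: (@le_lt_trans _ _ 3%:E); last by rewrite ltry.
apply: lime_le; first exact: is_cvg_nneseries.
apply: nearW => n; rewrite (eq_bigr _ (fun r _ => leb r)) sumEFin lee_fin.
rewrite big_mkord; apply: (@le_trans _ _ (\sum_(r < n) 3 / (r.+1%:R * r.+2%:R))).
  by apply: ler_sum => r _; exact: surv_run_length_le.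
by rewrite sum_inv_consecutive lerBlDr lerDl divr_ge0.
Qed.

Lemma infix_run n m x : infix (nseq m true) (itinerary alpha n x) ->
  exists p, (p + m <= n)%N /\
    forall i, (p <= i < p + m)%N -> 1 / 2 <= iter i T x.
Proof.
case/infixP => s [t e]; exists (size s).
have sz : size (itinerary alpha n x) = n by rewrite size_map size_iota.
move: (sz); rewrite e !size_cat size_nseq => szn.
have sn : (size s + m <= n)%N by rewrite -szn addnA leq_addr.
split=> //.
move=> i /andP[i1 i2].
have : nth false (itinerary alpha n x) i.
  rewrite e nth_cat ltnNge i1/= nth_cat size_nseq ltn_subLR// i2.
  by rewrite nth_nseq ltn_subLR// i2.
have iN : (i < n)%N := leq_trans i2 sn.
by rewrite /itinerary (nth_map 0%N) ?size_iota// nth_iota.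
Qed.

Lemma not_lim_sup_late_run x : 0 <= x < 1 -> ~ lim_sup_set late_run x ->
  exists N, forall r, (N <= r)%N ->
    exists p, (p + run_length r <= 2 ^ r)%N /\
      forall i, (p <= i < p + run_length r)%N -> 1 / 2 <= iter i T x.
Proof.
move=> x01 nx; apply: contrapT => h; apply: nx => N _.
apply: contrapT => k; apply: h; exists N => r Nr; apply: infix_run.
apply/negPn/negP => nr; apply: k; exists r => //; split; last by rewrite /= in_itv.
by split => //; exact: iter_intermittent_bounds.
Qed.

End almost_sure_runs.

(** * From runs to maximal averages *)

(** Used to compare a logarithm with a square root. *)
Lemma sqr_le_expn u : (u * u <= 2 * 2 ^ u)%N.
Proof.
have h v : ((v + 3) * (v + 3) <= 2 * 2 ^ (v + 3))%N.
  by elim: v => // v IH; rewrite addSn expnS; lia.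
by case: u => [|[|[|u]]] //; rewrite -addn3.
Qed.

Lemma double_le_expn r : (3 <= r)%N -> (2 * r.+1 <= 2 ^ r)%N.
Proof.
elim: r => // r IH; rewrite leq_eqVlt => /predU1P[<-//|/IH].
by rewrite expnS; lia.
Qed.

Section limit.
Context {R : realType}.

(** With [u] the logarithm, [u ^ 2] is at most of order [r], so that
    [(6 u) ^ 2 <= 288 (r + 1)], and this is below [(eta (r + 1)) ^ 2] as soon as
    [288 / eta ^ 2 <= r + 1]. *)
Lemma up_log_sublinear (eta : R) : 0 < eta ->
  exists N, forall r, (N <= r)%N ->
    4 * (up_log 2 r.+2)%:R + 2 <= eta * r.+1%:R.
Proof.
move=> eta0; exists (Num.trunc (288 / eta ^+ 2)).+1 => r Nr.
set u := up_log 2 r.+2.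
have u1 : (1 <= u)%N by rewrite up_log_gt0.
have ur : (u * u <= 8 * r.+1)%N.
  apply: (leq_trans (sqr_le_expn u)).
  have := @up_log_gtn 2 r.+2 isT isT; rewrite -/u.
  by case: (u) u1 => // v _; rewrite expnS/=; lia.
have hr : 288 <= eta ^+ 2 * r.+1%:R.
  rewrite mulrC -ler_pdivrMr ?exprn_gt0//.
  apply: (le_trans (ltW (truncnS_gt _))); rewrite ler_nat.
  by rewrite (leq_trans Nr).
have u1' : 1 <= u%:R :> R by rewrite ler1n.
apply: (@le_trans _ _ (6 * u%:R)); first lra.
have e0 : 0 <= eta * r.+1%:R by rewrite mulr_ge0// ltW.
rewrite -(@ler_pXn2r _ 2)// ?nnegrE ?mulr_ge0//.
have ur' : u%:R * u%:R <= 8 * r.+1%:R :> R by rewrite -!natrM ler_nat.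
have : 288 * r.+1%:R <= (eta ^+ 2 * r.+1%:R) * r.+1%:R by rewrite ler_wpM2r.
lra.
Qed.

Lemma log2_le_trunc_log (n : nat) : (0 < n)%N ->
  log2 (n%:R : R) <= (trunc_log 2 n).+1%:R.
Proof.
move=> n0; have l2 : 0 < ln (2 : R) by rewrite ln_gt0// ltr1n.
rewrite /log2 ler_pdivrMr// mulr_natl -lnXn ?ltr0n// ler_ln ?posrE ?ltr0n//.
by rewrite -natrX ler_nat ltnW// trunc_log_ltn.
Qed.

Lemma limn_esup_le1 (u : nat -> R) (d : R) : 0 < d ->
  (limn_esup (fun n => (u n)%:E) <= 1)%E ->
  exists N, forall n, (N <= n)%N -> u n < 1 + d.
Proof.
move=> d0; rewrite limn_esup_lim.
have /cvg_lim := @cvg_esups_inf _ (fun n => (u n)%:E); move=> -> // h.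
have : (ereal_inf (range (esups (fun n => (u n)%:E))) < (1 + d)%:E)%E.
  by apply: (le_lt_trans h); rewrite lte_fin ltrDl.
move=> /ereal_inf_lt[_ [N _ <-]] hN; exists N => n Nn.
rewrite -lte_fin; apply: le_lt_trans hN.
by apply: ereal_sup_ubound; exists n.
Qed.

Context (alpha : R) (halpha : 0 < alpha < 1).
Local Notation T := (intermittent_map alpha).
Local Notation chi := (\1_(`[1 / 2, 1[%classic) : R -> R).

Lemma max_birkhoff_le n k x : max_birkhoff_sum T chi n k x <= k%:R.
Proof.
apply: bigmax_le => // i _; rewrite /birkhoff_sum.
apply: (@le_trans _ _ (\sum_(1 <= i < k.+1) 1)).
  by apply: ler_sum => j _; rewrite indicE lern1 leq_b1.
by rewrite sumr_const_nat subn1.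
Qed.

(** The window of length [k] is placed so that it ends with the run, or at
    time [k] if the run ends before that.  One visit is lost in [l.-1] because
    a Birkhoff sum starts at the first iterate, while the run may start at
    time 0. *)
Lemma max_birkhoff_ge n k x p l : 0 <= x < 1 -> (p + l <= n)%N -> (k <= n)%N ->
  (forall i, (p <= i < p + l)%N -> 1 / 2 <= iter i T x) ->
  (minn k l.-1)%:R <= max_birkhoff_sum T chi n k x.
Proof.
move=> x01 pn kn run; set j := minn k l.-1.
have [->|j0] := posnP j; first exact: bigmax_ge_id.
pose i := ((p + l).-1 - k)%N.
apply: (@bigmax_sup_seq _ _ _ _ _ i).
- by rewrite mem_index_iota; lia.
- by lia.
have [a0 [ab bk]] : (1 <= p + l - j - i)%N /\ (p + l - j - i <= p + l - i)%N /\
    (p + l - i <= k.+1)%N by lia.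
rewrite /birkhoff_sum (big_cat_nat (n := p + l - j - i))//=; last by lia.
rewrite [X in _ + X](big_cat_nat (n := p + l - i))//=.
have pos a b : 0 <= \sum_(a <= c < b) chi (iter c T (iter i T x)).
  by apply: sumr_ge0 => c _; rewrite indicE.
have -> : \sum_(p + l - j - i <= c < p + l - i) chi (iter c T (iter i T x)) = j%:R.
  rewrite (eq_big_nat _ _ (F2 := fun=> 1)).
    by rewrite sumr_const_nat; congr (_%:R); lia.
  move=> c cI; rewrite -iterD indicE mem_set//= in_itv/= run; last by lia.
  by have /andP[] := iter_intermittent_bounds halpha (c + i) x01.
have := pos 1%N (p + l - j - i)%N; have := pos (p + l - i)%N k.+1; lra.
Qed.

(** Between times [2 ^ r] and [2 ^ (r + 1)] the run has length at least
    [r - o(r)] and [k n <= (1 + d) (r + 1)]; the loss [o(r)] is taken below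
    [d ^ 2 (r + 1)], so that the ratio is at least [1 - d], the quotient of
    [1 - d ^ 2] by [1 + d]. *)
Lemma max_birkhoff_average_cvg (k : nat -> nat) x :
  (forall n, (0 < n)%N -> (0 < k n)%N) ->
  (limn_esup (fun n => ((k n)%:R / log2 (n%:R : R))%:E) <= 1)%E ->
  0 <= x < 1 ->
  (exists N, forall r, (N <= r)%N ->
    exists p, (p + run_length r <= 2 ^ r)%N /\
      forall i, (p <= i < p + run_length r)%N -> 1 / 2 <= iter i T x) ->
  (fun n => max_birkhoff_sum T chi n (k n) x / (k n)%:R) @ \oo --> (1 : R).
Proof.
move=> k0 hk x01 [N1 runs]; apply/cvgrPdist_le => e e0.
pose d := Num.min e 1.
have d0 : 0 < d by rewrite lt_min e0/=.
have d1 : d <= 1 by rewrite ge_min lexx orbT.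
have de : d <= e by rewrite ge_min lexx.
have [N2 hN2] := limn_esup_le1 d0 hk.
have [N3 hN3] := up_log_sublinear (exprn_gt0 2 d0).
exists (N2 + 2 ^ (N1 + N3 + 3))%N => // n /= Nn.
have Nn2 : (N2 <= n)%N := leq_trans (leq_addr _ _) Nn.
have n2 : (2 ^ (N1 + N3 + 3) <= n)%N := leq_trans (leq_addl _ _) Nn.
have n0 : (0 < n)%N by rewrite (leq_trans _ n2)// expn_gt0.
pose r := trunc_log 2 n.
have rN : (N1 + N3 + 3 <= r)%N by exact: trunc_log_max.
have [rN1 rN3 r3] : [/\ N1 <= r, N3 <= r & 3 <= r]%N.
  by clear -rN; split; lia.
have rn : (2 ^ r <= n)%N by exact: trunc_logP.
have n1 : (1 < n)%N by rewrite (leq_trans _ rn)// -[1%N](expn0 2) ltn_exp2l// (leq_trans _ r3).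
have l0 : 0 < log2 (n%:R : R) by rewrite divr_gt0// ln_gt0 ?ltr1n.
have kr : (k n)%:R <= (1 + d) * r.+1%:R :> R.
  apply: (@le_trans _ _ ((1 + d) * log2 n%:R)).
    by rewrite -ler_pdivrMr// ltW// hN2.
  by rewrite ler_wpM2l ?log2_le_trunc_log//; lra.
have kn : (k n <= n)%N.
  apply: leq_trans rn; apply: leq_trans (double_le_expn r3).
  rewrite -(ler_nat R) natrM; apply: le_trans kr _.
  by rewrite ler_wpM2r//; lra.
have [p [pr run]] := runs r rN1.
have lower := max_birkhoff_ge x01 (leq_trans pr rn) kn run.
have kpos : 0 < (k n)%:R :> R by rewrite ltr0n k0.
have upper : max_birkhoff_sum T chi n (k n) x / (k n)%:R <= 1.
  by rewrite ler_pdivrMr// [leRHS]mul1r max_birkhoff_le.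
rewrite ger0_norm ?subr_ge0// lerBlDr -lerBlDl.
apply: (@le_trans _ _ (1 - d)); first lra.
rewrite ler_pdivlMr//; apply: le_trans lower.
have dk : 0 <= d * (k n)%:R by rewrite mulr_ge0 ?ltW.
rewrite /minn; case: ifP => _; first lra.
have hl : r%:R <= (run_length r).-1%:R + 4 * (up_log 2 r.+2)%:R + 1 :> R.
  rewrite -natrM -natrD natr1 ler_nat /run_length; clear; lia.
have hu := hN3 r rN3.
have h1 : (1 - d) * (k n)%:R <= (1 - d) * ((1 + d) * r.+1%:R).
  by rewrite ler_wpM2l//; lra.
apply: (le_trans h1); move: hl hu; rewrite -natr1 => hl hu; lra.
Qed.

End limit.

Theorem corollary3 (R : realType) (alpha : R) (halpha : 0 < alpha < 1)
    (mu : probability (measurableTypeR R) R)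
    (hmu : is_acip (intermittent_map alpha) mu)
    (k : nat -> nat) (hk_pos : forall n, (0 < n)%N -> (0 < k n)%N)
    (hk : (limn_esup (fun n => ((k n)%:R / log2 (n%:R : R))%:E) <= 1)%E) :
  {ae mu, forall x : R, `[0, 1[%classic x ->
    (fun n => max_birkhoff_sum (intermittent_map alpha) (\1_(`[1 / 2, 1[%classic))
                n (k n) x / (k n)%:R) @ \oo --> (1 : R)}.
Proof.
case: hmu => _ dom _.
have mL : measurable (lim_sup_set (late_run alpha)).
  by apply: bigcap_measurable => // n _; apply: bigcup_measurable => r _;
    exact: measurable_late_run.
exists (lim_sup_set (late_run alpha)); split => //.
  apply: (dom (lim_sup_set (late_run alpha))) => //.
  by apply/(measure0_null_setP _ mL); exact: lim_sup_late_run.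
move=> x; apply: contraPP => nx /=; apply => x01.
have {}x01 : 0 <= x < 1 by move: x01; rewrite /= in_itv.
apply: (max_birkhoff_average_cvg halpha) => //.
exact: (not_lim_sup_late_run halpha x01 nx).
Qed.
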